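(* Let $\mathbb{K}$ be a field of characteristic zero, $S=\mathbb{K}[x_1,x_2,x_3,x_4]$ with the standard grading, and $I\subset S$ a homogeneous ideal containing no nonzero linear form such that $A=S/I$ is an Artinian Gorenstein algebra with $H$-vector $(1,4,k,k,4,1)$ for some $k\in\{4,\dots,10\}$. If $A$ has the weak Lefschetz property, then $A$ has the strong Lefschetz property.
   Context: The $H$-vector of an Artinian graded algebra $A=S/I$ is $(1,h_1,\dots,h_s)$, where $h_i=\dim_{\mathbb{K}}A_i$ and $s$ is the socle degree, i.e. the largest $i$ with $A_i\neq 0$. A graded Artinian algebra $A$ has the weak Lefschetz property if there is a linear form $\ell\in A_1$ such that the multiplication map $\cdot\ell:A_i\to A_{i+1}$ has maximal rank (is injective or surjective) for all $i$. It has the strong Lefschetz property if there is a linear form $\ell\in A_1$ such that $\cdot\ell^{m}:A_i\to A_{i+m}$ has maximal rank for all $i$ and $m$. *)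

(* Defs.v *)
From HB Require Import structures.
From mathcomp Require Import all_boot all_algebra.
From mathcomp Require Import generic_quotient ring_quotient.
From mathcomp.multinomials Require Import mpoly.

Set Implicit Arguments.
Unset Strict Implicit.
Unset Printing Implicit Defensive.

Import GRing.Theory.

Local Open Scope ring_scope.
Local Open Scope quotient_scope.

(* [{ideal_quot I}] is only a commutative ring; [quot_alg I] is the same ring
   together with the induced K-algebra structure. *)
Definition quot_alg (K : fieldType) (n : nat) (I : idealr {mpoly K[n]}) :=
  {ideal_quot I}.

Section QuotAlg.
Variables (K : fieldType) (n : nat) (I : idealr {mpoly K[n]}).

HB.instance Definition _ :=
  GRing.ComNzRing.copy (quot_alg I) {ideal_quot I}.

Definition quot_cls (p : {mpoly K[n]}) : quot_alg I := \pi_{ideal_quot I} p.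

Lemma quot_clsD : {morph quot_cls : p q / p + q}.
Proof. exact: (rmorphD (\pi_{ideal_quot I})). Qed.

Lemma quot_clsM : {morph quot_cls : p q / p * q}.
Proof. exact: (rmorphM (\pi_{ideal_quot I})). Qed.

Lemma quot_cls1 : quot_cls 1 = 1.
Proof. exact: (rmorph1 (\pi_{ideal_quot I})). Qed.

Definition quot_scale (c : K) (a : quot_alg I) : quot_alg I :=
  quot_cls c%:MP * a.

Lemma quot_scaleA c d a :
  quot_scale c (quot_scale d a) = quot_scale (c * d) a.
Proof. by rewrite /quot_scale mulrA -quot_clsM -mpolyCM. Qed.

Lemma quot_scale1 : left_id 1 quot_scale.
Proof. by move=> a; rewrite /quot_scale mpolyC1 quot_cls1 mul1r. Qed.

Lemma quot_scaleDr : right_distributive quot_scale +%R.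
Proof. by move=> c a b; rewrite /quot_scale mulrDr. Qed.

Lemma quot_scaleDl a : {morph quot_scale^~ a : c d / c + d}.
Proof. by move=> c d; rewrite /quot_scale mpolyCD quot_clsD mulrDl. Qed.

HB.instance Definition _ := GRing.Zmodule_isLmodule.Build K (quot_alg I)
  quot_scaleA quot_scale1 quot_scaleDr quot_scaleDl.

Lemma quot_scaleAl (c : K) (a b : quot_alg I) : c *: (a * b) = c *: a * b.
Proof. exact: mulrA. Qed.

HB.instance Definition _ :=
  GRing.Lmodule_isLalgebra.Build K (quot_alg I) quot_scaleAl.
HB.instance Definition _ :=
  GRing.Lalgebra_isComAlgebra.Build K (quot_alg I).

End QuotAlg.

(* Meaningful for U a linear subspace of V. *)
Definition has_dim (K : fieldType) (V : lmodType K) (U : V -> Prop) (d : nat) :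
    Prop :=
  exists e : 'I_d -> V,
    [/\ forall i, U (e i),
        forall c : 'I_d -> K, \sum_i c i *: e i = 0 -> forall i, c i = 0
      & forall v, U v -> exists c : 'I_d -> K, v = \sum_i c i *: e i].

Definition is_ideal (R : comNzRingType) (J : R -> Prop) : Prop :=
  [/\ J 0,
      forall x y, J x -> J y -> J (x + y)
    & forall a x, J x -> J (a * x)].

Definition artinian (R : comNzRingType) : Prop :=
  forall J : nat -> R -> Prop,
    (forall m, is_ideal (J m)) ->
    (forall m x, J m.+1 x -> J m x) ->
    exists N : nat, forall m, (N <= m)%N -> forall x, J m x <-> J N x.

Section GradedQuotient.
Variables (K : fieldType) (n : nat) (I : idealr {mpoly K[n]}).

Definition homogeneous_ideal : Prop :=
  forall (p : {mpoly K[n]}) (d : nat), p \in I -> pihomog mdeg d p \in I.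

(* The degree d component A_d of A = S/I, as the image of S_d in A. *)
Definition graded_piece (d : nat) (a : quot_alg I) : Prop :=
  exists2 p : {mpoly K[n]}, p \is d.-homog & a = quot_cls I p.

Definition socle_degree (s : nat) : Prop :=
  (exists2 a, graded_piece s a & a != 0) /\
  (forall d, (s < d)%N -> forall a, graded_piece d a -> a = 0).

Definition H_vector (h : seq nat) : Prop :=
  exists s : nat,
    [/\ socle_degree s, size h = s.+1
      & forall i, (i <= s)%N -> has_dim (graded_piece i) (nth 0%N h i)].

(* The annihilator (0 :_A m) of the maximal ideal m, the sum of the A_d
   with d > 0. *)
Definition socle (a : quot_alg I) : Prop :=
  forall d b, (0 < d)%N -> graded_piece d b -> b * a = 0.

Definition artinian_gorenstein : Prop :=
  artinian (quot_alg I) /\ has_dim socle 1.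

Definition mul_maximal_rank (f : quot_alg I) (i j : nat) : Prop :=
  (forall a b, graded_piece i a -> graded_piece i b -> f * a = f * b -> a = b)
  \/ (forall b, graded_piece j b -> exists2 a, graded_piece i a & f * a = b).

Definition weak_Lefschetz : Prop :=
  exists2 l, graded_piece 1 l & forall i, mul_maximal_rank l i i.+1.

Definition strong_Lefschetz : Prop :=
  exists2 l, graded_piece 1 l &
    forall i m, mul_maximal_rank (l ^+ m) i (i + m).

End GradedQuotient.

(* Main.v *)
From HB Require Import structures.
Require Import Defs.
From mathcomp Require Import all_boot all_order all_algebra.
From mathcomp Require Import generic_quotient ring_quotient ring zify.
From mathcomp.multinomials Require Import mpoly.

(** Let x be the generic linear form, with coefficients in a polynomial ring
    K[X].  By symmetry of the H-vector it is enough that x^5 : A_0 -> A_5,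
    x^3 : A_1 -> A_4 and x : A_2 -> A_3 are injective over K[X]; a point where
    the three determinants do not vanish is then a strong Lefschetz element.
    The last map is the weak Lefschetz hypothesis, and x^5 <> 0 follows by
    differentiating in characteristic zero.

    Suppose x^3 h = 0 with h in A_1[X] non-zero, and write M y for the
    derivative of h in the direction y.  Differentiating x^3 h = 0 and
    multiplying by h gives in turn x^2 h^2 = 0, x h^3 = 0, h^4 = 0, and
    x^3 My = -3 x^2 h y, x^3 M^2 y = 3 x h^2 y, x^3 M^3 y = - h^3 y,
    x^3 M^4 y = 0.  So M is nilpotent modulo the kernel of x^3, and as A_1 has
    rank 4 and both h and x split off, x^3 M^2 = 0, that is x h^2 = 0; the weak
    Lefschetz property yields h^2 = 0.  Let u, v, w be the first three
    derivatives of h along a constant direction b with x^2 h b^2 <> 0.  Then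
    hu = 0, u^2 = -hv and 3uv = -hw, whence h v^2 = 0; moreover h, u, v, x are
    all orthogonal to u, but b is not, for the form (y, z) |-> x^3 y z.  By
    rank x lies in the span of h, u, v, so x^2 h is a multiple of h v^2 = 0,
    contradicting the weak Lefschetz property. *)

Set Implicit Arguments.
Unset Strict Implicit.
Unset Printing Implicit Defensive.

Import GRing.Theory Order.TTheory.
Local Open Scope ring_scope.

(** * The kernel of the cube of the generic linear form *)

Definition derivation (R : comNzRingType) (D : R -> R) : Prop :=
  {morph D : p q / p + q} /\ forall p q, D (p * q) = D p * q + p * D q.

Section Derivation.
Variables (R : comNzRingType) (D : R -> R).
Hypothesis derD : derivation D.

Lemma derivation0 : D 0 = 0.
Proof. by case: derD => DA _; apply: (addIr (D 0)); rewrite -DA !add0r. Qed.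

Lemma derivationM p q : D (p * q) = D p * q + p * D q.
Proof. by case: derD => _; apply. Qed.

Lemma derivationX p k : D (p ^+ k.+1) = k.+1%:R * p ^+ k * D p.
Proof.
elim: k => [|k IHk]; first by rewrite expr1 expr0 !mul1r.
by rewrite exprS derivationM IHk -[k.+2%:R]natr1 exprS; ring.
Qed.

End Derivation.

(* [H d] plays the role of A_d[x], the polynomials with coefficients in A_d,
   [S] of K[x] and [C] of the constant elements of A_1[x]; [dep] says that
   A_1[x] has rank at most 4 over K[x]. *)
Section GenericLinearForm.
Variables (S : idomainType) (R : comNzRingType) (iota : {rmorphism S -> R}).
Variables (H : nat -> R -> Prop) (C : R -> Prop) (x : R).
Hypothesis natS : forall n, n.+1%:R != 0 :> S.
Hypothesis torsion_free : forall c p, c != 0 -> iota c * p = 0 -> p = 0.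
Hypothesis HM : forall d e p q, H d p -> H e q -> H (d + e) (p * q).
Hypothesis dep : forall y0 y1 y2 y3 y4,
  H 1 y0 -> H 1 y1 -> H 1 y2 -> H 1 y3 -> H 1 y4 ->
  exists c0 c1 c2 c3 c4,
    ~ [/\ c0 = 0, c1 = 0, c2 = 0, c3 = 0 & c4 = 0] /\
    iota c0 * y0 + iota c1 * y1 + iota c2 * y2 + iota c3 * y3 + iota c4 * y4
      = 0.
Hypothesis Hx : H 1 x.
Hypothesis H_nondeg : forall d p,
  (d <= 4)%N -> H d p -> (forall b, C b -> b * p = 0) -> p = 0.
Hypothesis HC : forall b, C b -> H 1 b.
Hypothesis CD : forall b c, C b -> C c -> C (b + c).
Hypothesis direction : forall y, H 1 y ->
  exists D, [/\ derivation D, D x = y & forall p, H 1 p -> H 1 (D p)].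
Hypothesis constant_direction : forall b, C b ->
  exists D, [/\ derivation D, D x = b, D b = 0 & forall p, H 1 p -> H 1 (D p)].

Lemma natr_regular n (p : R) : n.+1%:R * p = 0 -> p = 0.
Proof. by rewrite -(rmorph_nat iota); apply/torsion_free/natS. Qed.

Lemma torsion_free_coef c (p : R) : p <> 0 -> iota c * p = 0 -> c = 0.
Proof. by move=> p0 cp; apply/eqP/negPn/negP => /torsion_free/(_ cp). Qed.

Lemma HX k : H k.+1 (x ^+ k.+1).
Proof. by elim: k => [|k IHk]; rewrite ?expr1// exprS; apply: (HM Hx IHk). Qed.

(** Differentiating [x ^+ k.+2 = 0] along a constant [c] gives [c * x ^+ k.+1 = 0] up to a nonzero
    integer, and nondegeneracy lowers the exponent. This descends to [x = 0], absurd since some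
    derivation sends [x] to [b]. *)
Lemma generic_power_neq0 : (exists2 b, C b & b <> 0) -> x ^+ 5 <> 0.
Proof.
case=> b Cb b0 x5.
have step k : (k < 4)%N -> x ^+ k.+2 = 0 -> x ^+ k.+1 = 0.
  move=> k4 xk; apply: (H_nondeg k4 (HX k)) => c Cc.
  have [D [derD Dx _ _]] := constant_direction Cc.
  apply: (@natr_regular k.+1).
  have := congr1 D xk; rewrite (derivationX derD) Dx (derivation0 derD) => <-.
  by ring.
have x1 : x = 0.
  by rewrite -[x]expr1; apply: (step 0%N) => //; apply: (step 1%N) => //;
     apply: (step 2%N) => //; apply: (step 3%N).
have [D [derD Dx _ _]] := constant_direction Cb.
by apply: b0; rewrite -Dx x1 (derivation0 derD).
Qed.

Hypothesis x5 : x ^+ 5 <> 0.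
Hypothesis x_inj1 : forall p, H 1 p -> x * p = 0 -> p = 0.
Hypothesis x_inj2 : forall p, H 2 p -> x * p = 0 -> p = 0.

Section Kernel.
Variable h : R.
Hypothesis Hh : H 1 h.
Hypothesis hker : x ^+ 3 * h = 0.

Lemma kernel_derivative1 D : derivation D ->
  3%:R * x ^+ 2 * D x * h + x ^+ 3 * D h = 0.
Proof.
move=> derD; rewrite -[RHS](derivation0 derD) -hker.
by rewrite (derivationM derD) (derivationX derD).
Qed.

(** Multiplying the differentiated relation by [h] removes the unknown [D h], because
    [x ^+ 3 * h = 0]; the remaining term shows that every constant kills [x ^+ 2 * h ^+ 2]. The next
    two powers repeat this, trading one factor [x] for [h] each time. *)
Lemma kernel_power2 : x ^+ 2 * h ^+ 2 = 0.
Proof.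
apply: (@H_nondeg 4) => //; first exact: HM (HX 1) (HM Hh Hh).
move=> b /HC/direction[D [derD <- _]]; apply: (@natr_regular 2).
transitivity (h * (3%:R * x ^+ 2 * D x * h + x ^+ 3 * D h)
              - (x ^+ 3 * h) * D h); first by ring.
by rewrite kernel_derivative1 // hker; ring.
Qed.

Lemma kernel_derivative2 D : derivation D ->
  x * D x * h ^+ 2 + x ^+ 2 * h * D h = 0.
Proof.
move=> derD; apply: (@natr_regular 1).
rewrite -[RHS](derivation0 derD) -kernel_power2.
by rewrite (derivationM derD) !(derivationX derD); ring.
Qed.

Lemma kernel_power3 : x * h ^+ 3 = 0.
Proof.
apply: (@H_nondeg 4) => //; first exact: HM Hx (HM Hh (HM Hh Hh)).
move=> b /HC/direction[D [derD <- _]].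
transitivity (h * (x * D x * h ^+ 2 + x ^+ 2 * h * D h)
              - (x ^+ 2 * h ^+ 2) * D h); first by ring.
by rewrite kernel_derivative2 // kernel_power2; ring.
Qed.

Lemma kernel_derivative3 D : derivation D ->
  D x * h ^+ 3 + 3%:R * x * h ^+ 2 * D h = 0.
Proof.
move=> derD; rewrite -[RHS](derivation0 derD) -kernel_power3.
by rewrite (derivationM derD) (derivationX derD); ring.
Qed.

Lemma kernel_power4 : h ^+ 4 = 0.
Proof.
apply: (@H_nondeg 4) => //; first exact: HM Hh (HM Hh (HM Hh Hh)).
move=> b /HC/direction[D [derD <- _]].
transitivity (h * (D x * h ^+ 3 + 3%:R * x * h ^+ 2 * D h)
              - 3%:R * (x * h ^+ 3) * D h); first by ring.
by rewrite kernel_derivative3 // kernel_power3; ring.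
Qed.

Lemma kernel_derivative4 D : derivation D -> h ^+ 3 * D h = 0.
Proof.
move=> derD; apply: (@natr_regular 3).
rewrite -[RHS](derivation0 derD) -kernel_power4 (derivationX derD); ring.
Qed.

(* [u] is the derivative of [h] in the direction [y]. *)
Lemma kernel_derivativeP y (Hy : H 1 y) : exists2 u, H 1 u &
  [/\ x ^+ 3 * u = - (3%:R * x ^+ 2 * y * h),
      x ^+ 2 * h * u = - (x * y * h ^+ 2),
      3%:R * (x * h ^+ 2 * u) = - (y * h ^+ 3)
    & h ^+ 3 * u = 0].
Proof.
have [D [derD Dx DH]] := direction Hy.
exists (D h); first exact: DH.
rewrite -Dx; split; last exact: kernel_derivative4.
- by apply: (addrI (3%:R * x ^+ 2 * D x * h));
     rewrite subrr kernel_derivative1.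
- by apply: (addrI (x * D x * h ^+ 2)); rewrite subrr kernel_derivative2.
- apply: (addrI (D x * h ^+ 3)); rewrite subrr.
  by rewrite -[RHS](kernel_derivative3 derD); ring.
Qed.

(** If [b * h ^+ 3 <> 0], then [h], [x], [b], [u], [v] are independent, against rank 4. Indeed
    [x * h ^+ 2 * u] and [x ^+ 2 * h * v] are nonzero rational multiples of [b * h ^+ 3], so testing
    a relation against [h ^+ 3], [x * h ^+ 2], [x ^+ 2 * h] and [x ^+ 4] in turn is triangular. *)
Lemma kernel_cube : h <> 0 -> h ^+ 3 = 0.
Proof.
move=> h0; apply: (@H_nondeg 3) => //; first exact: HM Hh (HM Hh Hh).
move=> b /HC Hb; have [//|/eqP bh3] := eqVneq (b * h ^+ 3) 0; exfalso.
have [u Hu [_ u2 u3 u4]] := kernel_derivativeP Hb.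
have [v Hv [_ v2 v3 v4]] := kernel_derivativeP Hu.
have [c0 [c1 [c2 [c3 [c4 [nz rel]]]]]] := dep Hh Hx Hb Hu Hv.
apply: nz.
have e2 : c2 = 0.
  apply: (torsion_free_coef bh3); rewrite -[RHS](mulr0 (h ^+ 3)) -rel.
  transitivity (iota c2 * (b * h ^+ 3) + iota c0 * h ^+ 4
    + iota c1 * (x * h ^+ 3) + iota c3 * (h ^+ 3 * u)
    + iota c4 * (h ^+ 3 * v)); last by ring.
  by rewrite kernel_power4 kernel_power3 u4 v4; ring.
have e3 : c3 = 0.
  apply: (torsion_free_coef bh3).
  rewrite -[RHS](mulr0 (- 3%:R * (x * h ^+ 2))) -rel e2 rmorph0.
  transitivity (- iota c3 * (3%:R * (x * h ^+ 2 * u))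
    - 3%:R * iota c0 * (x * h ^+ 3) - 3%:R * iota c1 * (x ^+ 2 * h ^+ 2)
    - iota c4 * (3%:R * (x * h ^+ 2 * v))); last by ring.
  rewrite kernel_power3 kernel_power2 u3 v3 [u * _]mulrC u4; ring.
have e4 : c4 = 0.
  apply: (torsion_free_coef bh3).
  rewrite -[RHS](mulr0 (3%:R * x ^+ 2 * h)) -rel e2 e3 rmorph0.
  transitivity (3%:R * iota c0 * (x ^+ 2 * h ^+ 2)
    + 3%:R * iota c1 * (x ^+ 3 * h)
    + 3%:R * iota c4 * (x ^+ 2 * h * v)); last by ring.
  rewrite hker kernel_power2 v2.
  transitivity (- iota c4 * (3%:R * (x * h ^+ 2 * u))); last by ring.
  by rewrite u3; ring.
have e1 : c1 = 0.
  apply: (torsion_free_coef x5).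
  rewrite -[RHS](mulr0 (x ^+ 4)) -rel e2 e3 e4 rmorph0.
  transitivity (iota c0 * x * (x ^+ 3 * h) + iota c1 * x ^+ 5); last by ring.
  by rewrite hker; ring.
split => //; apply: (torsion_free_coef h0).
by rewrite -[RHS]rel e1 e2 e3 e4 rmorph0; ring.
Qed.

(** The independence argument again, now started from [b * (x * h ^+ 2) <> 0]: as [h ^+ 3 = 0], the
    tests [x * h ^+ 2], [x ^+ 2 * h], [x ^+ 4], [x ^+ 3] are triangular. The factor [x] is then
    cancelled in degree 2. *)
Lemma kernel_square : h <> 0 -> h ^+ 2 = 0.
Proof.
move=> h0; have h3 := kernel_cube h0.
apply: x_inj2; first exact: HM Hh Hh.
apply: (@H_nondeg 3) => //; first exact: HM Hx (HM Hh Hh).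
move=> b /HC Hb; have [//|/eqP bh2] := eqVneq (b * (x * h ^+ 2)) 0; exfalso.
have [u Hu [u1 u2 u3 _]] := kernel_derivativeP Hb.
have [v Hv [v1 v2 v3 _]] := kernel_derivativeP Hu.
have {}u3 : x * h ^+ 2 * u = 0.
  by apply: (@natr_regular 2); rewrite u3 h3; ring.
have {}v3 : x * h ^+ 2 * v = 0.
  by apply: (@natr_regular 2); rewrite v3 h3; ring.
have [c0 [c1 [c2 [c3 [c4 [nz rel]]]]]] := dep Hh Hx Hb Hu Hv.
apply: nz.
have e2 : c2 = 0.
  apply: (torsion_free_coef bh2); rewrite -[RHS](mulr0 (x * h ^+ 2)) -rel.
  transitivity (iota c2 * (b * (x * h ^+ 2)) + iota c0 * x * h ^+ 3
    + iota c1 * (x ^+ 2 * h ^+ 2) + iota c3 * (x * h ^+ 2 * u)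
    + iota c4 * (x * h ^+ 2 * v)); last by ring.
  by rewrite h3 kernel_power2 u3 v3; ring.
have e3 : c3 = 0.
  apply: (torsion_free_coef bh2).
  rewrite -[RHS](mulr0 (- (x ^+ 2 * h))) -rel e2 rmorph0.
  transitivity (- iota c3 * (x ^+ 2 * h * u) - iota c4 * (x ^+ 2 * h * v)
    - iota c0 * (x ^+ 2 * h ^+ 2) - iota c1 * (x ^+ 3 * h)); last by ring.
  rewrite u2 v2 kernel_power2 hker.
  transitivity (iota c3 * (b * (x * h ^+ 2)) + iota c4 * (x * h ^+ 2 * u));
    last by ring.
  by rewrite u3; ring.
have e1 : c1 = 0.
  apply: (torsion_free_coef x5).
  rewrite -[RHS](mulr0 (x ^+ 4)) -rel e2 e3 rmorph0.
  transitivity (iota c0 * x * (x ^+ 3 * h) + iota c1 * x ^+ 5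
    + iota c4 * x * (x ^+ 3 * v)); last by ring.
  rewrite v1 hker.
  transitivity (iota c1 * x ^+ 5 - iota c4 * 3%:R * h * (x ^+ 3 * u));
    last by ring.
  rewrite u1.
  transitivity (iota c1 * x ^+ 5
    + iota c4 * 9%:R * b * (x ^+ 2 * h ^+ 2)); last by ring.
  by rewrite kernel_power2; ring.
have e4 : c4 = 0.
  apply: (torsion_free_coef bh2); apply: (@natr_regular 2).
  rewrite -[RHS](mulr0 (x ^+ 3)) -rel e1 e2 e3 rmorph0.
  transitivity (iota c0 * (x ^+ 3 * h) + iota c4 * (x ^+ 3 * v));
    last by ring.
  rewrite v1 hker.
  transitivity (- 3%:R * iota c4 * (x ^+ 2 * h * u)); last by ring.
  by rewrite u2; ring.
split => //; apply: (torsion_free_coef h0).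
by rewrite -[RHS]rel e1 e2 e3 e4 rmorph0; ring.
Qed.

(* Once [h ^+ 2 = 0], the derivatives [u], [v], [w] of [h] along a constant
   direction [b] with [x ^+ 2 * h * b ^+ 2 <> 0] force [x] into the span of
   [h], [u], [v], and then [h * u = h * v ^+ 2 = 0] gives [x ^+ 2 * h = 0]. *)
Lemma kernel_direction b : h <> 0 -> C b -> x ^+ 2 * h <> 0 ->
  x ^+ 2 * h * b ^+ 2 = 0.
Proof.
move=> h0 Cb x2h.
have [//|/eqP bb] := eqVneq (x ^+ 2 * h * b ^+ 2) 0; exfalso.
have h2 := kernel_square h0.
have [D [derD Dx Db DH]] := constant_direction Cb.
have [[D0 DM] DX] := (derivation0 derD, derivationM derD, derivationX derD).
have [DA _] := derD.
have Hu := DH _ Hh; have Hv := DH _ Hu.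
pose u := D h; pose v := D u; pose w := D v.
have hu : h * u = 0.
  by apply: (@natr_regular 1); rewrite -[RHS]D0 -h2 DX -/u; ring.
have hv : u ^+ 2 + h * v = 0 by rewrite -[RHS]D0 -hu DM -/u -/v; ring.
have hw : 3%:R * (u * v) + h * w = 0.
  by rewrite -[RHS]D0 -hv DA DM DX -/u -/v -/w; ring.
have x3u : 3%:R * x ^+ 2 * b * h + x ^+ 3 * u = 0.
  by rewrite -Dx kernel_derivative1.
have x4u : x ^+ 4 * u = 0.
  transitivity (x * (3%:R * x ^+ 2 * b * h + x ^+ 3 * u)
    - 3%:R * b * (x ^+ 3 * h)); first by ring.
  by rewrite x3u hker; ring.
have x3bu : x ^+ 3 * b * u <> 0.
  move=> e; apply: bb; apply: (@natr_regular 2).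
  transitivity (b * (3%:R * x ^+ 2 * b * h + x ^+ 3 * u)
    - x ^+ 3 * b * u); first by ring.
  by rewrite x3u e; ring.
have x3uu : x ^+ 3 * u ^+ 2 = 0.
  transitivity (x ^+ 3 * (u ^+ 2 + h * v) - (x ^+ 3 * h) * v); first by ring.
  by rewrite hv hker; ring.
(* By [hv] and [x3u], [3 x^2 b u^2 = - 3 x^2 b h v = x^3 u v], so the derivative of [x^3 u^2] is
   [3 x^3 u v]. *)
have x3uv : x ^+ 3 * u * v = 0.
  apply: (@natr_regular 2).
  transitivity (D (x ^+ 3 * u ^+ 2) - 3%:R * x ^+ 2 * b * (u ^+ 2 + h * v)
    + (3%:R * x ^+ 2 * b * h + x ^+ 3 * u) * v); last first.
    by rewrite x3uu hv x3u D0; ring.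
  by rewrite DM !DX Dx -/u -/v; ring.
have x4v : x ^+ 4 * v <> 0.
  move=> e; apply: x3bu; apply: (@natr_regular 3).
  transitivity (D (x ^+ 4 * u) - x ^+ 4 * v); last by rewrite x4u e D0; ring.
  by rewrite DM DX Dx -/u -/v; ring.
(* Eliminating [u^2 v] between [hv] and [hw] leaves [3 h v^2 = h u w], which is zero by [hu]. *)
have hvv : h * v ^+ 2 = 0.
  apply: (@natr_regular 2).
  transitivity (3%:R * v * (u ^+ 2 + h * v) - u * (3%:R * (u * v) + h * w)
    + (h * u) * w); first by ring.
  by rewrite hv hw hu; ring.
have [c0 [c1 [c2 [c3 [c4 [nz rel]]]]]] := dep Hh Hu Hv Hx (HC Cb).
rewrite -/u -/v in rel.
have e4 : c4 = 0.
  apply: (torsion_free_coef x3bu); rewrite -[RHS](mulr0 (x ^+ 3 * u)) -rel.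
  transitivity (iota c4 * (x ^+ 3 * b * u) + iota c0 * x ^+ 3 * (h * u)
    + iota c1 * (x ^+ 3 * u ^+ 2) + iota c2 * (x ^+ 3 * u * v)
    + iota c3 * (x ^+ 4 * u)); last by ring.
  by rewrite hu x3uu x3uv x4u; ring.
(* If [c3 = 0], then [x ^+ 4] isolates [v], next [x ^+ 3 * b] isolates [u], and the relation is
   trivial. *)
have [e3|c3nz] := eqVneq c3 0.
  apply: nz.
  have e2 : c2 = 0.
    apply: (torsion_free_coef x4v).
    rewrite -[RHS](mulr0 (x ^+ 4)) -rel e3 e4 rmorph0.
    transitivity (iota c0 * x * (x ^+ 3 * h) + iota c1 * (x ^+ 4 * u)
      + iota c2 * (x ^+ 4 * v)); last by ring.
    by rewrite hker x4u; ring.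
  have e1 : c1 = 0.
    apply: (torsion_free_coef x3bu).
    rewrite -[RHS](mulr0 (x ^+ 3 * b)) -rel e2 e3 e4 rmorph0.
    transitivity (iota c1 * (x ^+ 3 * b * u) + iota c0 * b * (x ^+ 3 * h));
      last by ring.
    by rewrite hker; ring.
  split => //; apply: (torsion_free_coef h0).
  by rewrite -[RHS]rel e1 e2 e3 e4 rmorph0; ring.
apply/x2h/(torsion_free c3nz)/(torsion_free c3nz).
rewrite e4 rmorph0 mul0r addr0 in rel.
have c3x : iota c3 * x = - (iota c0 * h + iota c1 * u + iota c2 * v).
  by apply/eqP; rewrite -addr_eq0 addrC rel.
transitivity (h * (iota c3 * x) ^+ 2); first by ring.
rewrite c3x; transitivity (iota c0 * h ^+ 2
    * (iota c0 * h + 2%:R * iota c1 * u + 2%:R * iota c2 * v)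
  + iota c1 * (h * u) * (iota c1 * u + 2%:R * iota c2 * v)
  + iota c2 ^+ 2 * (h * v ^+ 2)); first by ring.
by rewrite h2 hu hvv; ring.
Qed.

(** Polarization: the quadratic form [x ^+ 2 * h * b ^+ 2] vanishes on constants, hence so does its
    bilinear form, and nondegeneracy applied twice yields [x ^+ 2 * h = 0], against injectivity of
    [x] in degrees 1 and 2. *)
Lemma kernel_trivial : h = 0.
Proof.
have [//|/eqP h0] := eqVneq h 0; exfalso.
have x2h : x ^+ 2 * h <> 0.
  rewrite expr2 -mulrA => /(x_inj2 (HM Hx Hh)).
  by move/(x_inj1 Hh).
have sq b : C b -> x ^+ 2 * h * b ^+ 2 = 0.
  by move=> Cb; apply: kernel_direction.
apply: x2h; apply: (@H_nondeg 3) => //; first exact: HM (HX 1) Hh.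
move=> b Cb; apply: (@H_nondeg 4) => //.
  exact: HM (HC Cb) (HM (HX 1) Hh).
move=> c Cc; apply: (@natr_regular 1).
transitivity (x ^+ 2 * h * (b + c) ^+ 2 - x ^+ 2 * h * b ^+ 2
  - x ^+ 2 * h * c ^+ 2); first by ring.
by rewrite !sq ?subr0 //; apply: CD.
Qed.

End Kernel.
End GenericLinearForm.

(** * Non-vanishing of polynomials at points *)

Section Nonvanishing.
Variables (K : fieldType) (n : nat).
Hypothesis charK : [pchar K] =i pred0.

Lemma natr_neq0 m : m.+1%:R != 0 :> K.
Proof. by have /pcharf0P -> := charK. Qed.

Lemma mnm_neq0 (m : 'X_{1..n}) : m <> 0%MM -> exists i, m i != 0%N.
Proof.
move=> m0; apply/existsP; apply: contra_notT m0.
rewrite negb_exists => /forallP m0.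
by apply/mnmP => j; rewrite mnm0E; apply/eqP/negPn/m0.
Qed.

Lemma natr_inj : injective (fun m => m%:R : K).
Proof.
move=> i j; wlog: i j / (i <= j)%N.
  by move=> wl e; have [/wl|/ltnW/wl] := leqP i j => ->.
move=> ij e; apply/eqP; rewrite eqn_leq ij -subn_eq0 /=.
by have /pcharf0P <- := charK; rewrite natrB // e subrr.
Qed.

(** In characteristic zero the integers below [size q] are distinct in [K], too many to be all
    roots. *)
Lemma poly_nonroot (q : {poly K}) : q != 0 -> exists t, q.[t] != 0.
Proof.
move=> q0; pose rs := [seq m%:R : K | m <- iota 0 (size q)].
have [rs0|/allPn[t _ qt]] := boolP (all (root q) rs); last by exists t.
case/eqP: q0; apply: roots_geq_poly_eq0 rs0 _ _.
- by rewrite map_inj_uniq ?iota_uniq //; apply: natr_inj.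
- by rewrite size_map size_iota.
Qed.

Section Line.
Variables (v : 'I_n -> K) (i : 'I_n).

(** The restriction of [p] to the line through [v] parallel to the [i]-th axis. *)
Let line (p : {mpoly K[n]}) : {poly K} :=
  mmap polyC (fun j => (v j)%:P + (j == i)%:R *: 'X) p.

Let lineM : {morph line : p q / p * q}.
Proof. by move=> p q; rewrite /line rmorphM. Qed.

Let lineE (p : {mpoly K[n]}) t :
  (line p).[t] = p.@[fun j => v j + (j == i)%:R * t].
Proof.
elim/mpolyind: p => [|c m p _ _ IH]; first by rewrite /line !raddf0 horner0.
rewrite /line !raddfD /= hornerD IH; congr (_ + _).
rewrite mmapZ mmapX hornerM hornerC mevalZ mevalX; congr (_ * _).
rewrite /mmap1 horner_prod; apply: eq_bigr => j _.
by rewrite horner_exp !hornerE.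
Qed.

Let line_deriv (p : {mpoly K[n]}) : (line p)^`() = line p^`M(i).
Proof.
pose P (q : {mpoly K[n]}) := (line q)^`() = line q^`M(i).
have PM q r : P q -> P r -> P (q * r).
  by rewrite /P lineM derivM mderivM => -> ->; rewrite /line raddfD /= !rmorphM.
have P1 : P 1.
  by rewrite /P mderivC /line rmorph0 rmorph1 derivC.
have PX m : P 'X_[m].
  rewrite mpolyXE_id; apply: (big_ind P) => // j _.
  elim: (m j) => [//|k IH]; rewrite exprS; apply: PM => //.
  rewrite /P /line mmapX mmap1U mderivX mmapZ mmapX mnm1E.
  rewrite derivD derivC add0r derivZ derivX eq_sym.
  case: eqP => [<-|_]; last by rewrite !mulr0n rmorph0 mul0r scale0r.
  have -> : (U_(i) - U_(i) = 0)%MM.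
    by apply/mnmP => l; rewrite mnmBE mnm0E subnn.
  by rewrite mmap11 scale1r rmorph1 mulr1.
elim/mpolyind: p => [|c m p _ _ IH]; first by rewrite mderiv0 /line !raddf0.
rewrite mderivD /line !raddfD /= -/line IH; congr (_ + _).
by rewrite mderivZ !mmapZ derivM derivC mul0r add0r PX.
Qed.

(** If [p] vanished everywhere, its restriction to the line would be the zero polynomial, and so
    would the derivative of that restriction, whose value at 0 is the partial derivative at [v]. *)
Lemma nonvanishing_deriv (p : {mpoly K[n]}) :
  p^`M(i).@[v] != 0 -> exists w, p.@[w] != 0.
Proof.
move=> dp; have [|t] := @poly_nonroot (line p); last first.
  by rewrite lineE => pt; exists (fun j => v j + (j == i)%:R * t).
apply: contraNneq dp => l0.
have := congr1 (fun q => q^`().[0]) l0.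
rewrite line_deriv lineE deriv0 horner0 => e; rewrite -[X in _ == X]e.
by apply/eqP/meval_eq => j; rewrite mulr0 addr0.
Qed.

End Line.

(** Induction on the degree of a monomial with nonzero coefficient: a partial derivative lowers the
    degree and multiplies the coefficient by a nonzero integer. In degree 0 the coefficient is the
    value at the origin. *)
Lemma mpoly_nonzero_point (p : {mpoly K[n]}) :
  p != 0 -> exists v, p.@[v] != 0.
Proof.
move=> p0.
have [m pm] : exists m, p@_m != 0.
  by exists (mlead p); rewrite mleadc_eq0.
elim: {m}(mdeg m) {-2}m (erefl (mdeg m)) p pm {p0} => [|d IH] m dm p pm.
  exists (fun _ => 0); move: pm; congr (_ != 0).
  move/eqP: dm; rewrite mdeg_eq0 => /eqP ->.
  elim/mpolyind: p => [|c k p _ _ IHp]; first by rewrite mcoeff0 meval0.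
  rewrite mcoeffD mevalD IHp mcoeffZ mevalZ mcoeffX mevalX; congr (_ * _ + _).
  have [->|/eqP k0] := eqVneq k 0%MM.
    by rewrite big1 // => j _; rewrite mnm0E expr0.
  have [j kj] := mnm_neq0 k0.
  by rewrite (bigD1 j) //= expr0n (negPf kj) mul0r.
have [i mi] : exists i, m i != 0%N.
  by apply: mnm_neq0 => m0; rewrite m0 mdeg0 in dm.
have me : m = (m - U_(i) + U_(i))%MM by rewrite submK // lep1mP.
have [||v pv] := IH (m - U_(i))%MM _ p^`M(i).
- by move: dm; rewrite {1}me mdegD mdeg1 addn1 => -[].
- by rewrite mcoeff_deriv -me -mulr_natr mulf_neq0 // natr_neq0.
exact: nonvanishing_deriv pv.
Qed.

End Nonvanishing.

(** * Polynomials over a graded algebra *)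

Section ScalarExtension.
Variables (K : fieldType) (A : comAlgType K) (n : nat).

Definition scalar_poly : {mpoly K[n]} -> {mpoly A[n]} :=
  map_mpoly (GRing.in_alg A).

HB.instance Definition _ := GRing.RMorphism.on scalar_poly.

Lemma mcoeff_scalarMC c (a : A) m :
  (scalar_poly c * a%:MP)@_m = c@_m *: a.
Proof. by rewrite mulrC mcoeffCM mcoeff_map_mpoly mulr_algr. Qed.

Lemma scalar_polyC c (a : A) : scalar_poly c%:MP * a%:MP = (c *: a)%:MP.
Proof. by rewrite /scalar_poly map_mpolyC -mpolyCM mulr_algl. Qed.

Lemma meval_scalar_poly c (v : 'I_n -> K) :
  (scalar_poly c).@[fun i => (v i)%:A] = c.@[v]%:A.
Proof.
elim/mpolyind: c => [|c m p _ _ IH]; first by rewrite rmorph0 !meval0 scale0r.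
rewrite rmorphD !mevalD IH scalerDl; congr (_ + _).
rewrite /= /scalar_poly map_mpolyZ map_mpolyX !mevalZ !mevalX.
rewrite -[RHS]/(GRing.in_alg A _) rmorphM rmorph_prod; congr (_ * _).
by apply: eq_bigr => i _; rewrite rmorphXn.
Qed.

(** [A] may have zero divisors, but the leading coefficient of the product is a nonzero scalar times
    a nonzero vector. *)
Lemma scalar_poly_torsion_free c p :
  c != 0 -> scalar_poly c * p = 0 -> p = 0.
Proof.
move=> c0 cp; apply/eqP; rewrite -mleadc_eq0.
have lc : (mlead (scalar_poly c) <= mlead c)%O.
  have [->|nz] := eqVneq (scalar_poly c) 0; first by rewrite mlead0 le0x.
  rewrite leNgt; apply/negP => /mcoeff_gt_mlead.
  move/mlead_supp: nz; rewrite mcoeff_msupp mcoeff_map_mpoly => /eqP nz e.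
  by apply: nz; rewrite /= e scale0r.
have := congr1 (mcoeff (mlead c + mlead p)%MM) cp.
rewrite mleadcMW // mcoeff0 mcoeff_map_mpoly /= mulr_algl => /eqP.
by rewrite scaler_eq0 !mleadc_eq0 (negPf c0).
Qed.

End ScalarExtension.

Section GradedPolynomials.
Variables (K : fieldType) (A : comAlgType K) (G : nat -> A -> Prop).
Hypothesis G0 : forall d, G d 0.
Hypothesis GD : forall d a b, G d a -> G d b -> G d (a + b).
Hypothesis GZ : forall d c a, G d a -> G d (c *: a).
Hypothesis GM : forall d e a b, G d a -> G e b -> G (d + e) (a * b).

(** The degree [d] is that of the coefficients; the degree in the variables is unrestricted. *)
Definition piece_poly (n d : nat) (p : {mpoly A[n]}) : Prop :=
  forall m, G d p@_m.

Section Fixed.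
Variable n : nat.
Local Notation piece_poly := (@piece_poly n).
Local Notation sc := (@scalar_poly K A n).

Lemma G_sum d (I : Type) (r : seq I) (P : pred I) (F : I -> A) :
  (forall i, P i -> G d (F i)) -> G d (\sum_(i <- r | P i) F i).
Proof. by move=> GF; apply: big_ind => //; apply: GD. Qed.

Lemma piece_polyD d p q :
  piece_poly d p -> piece_poly d q -> piece_poly d (p + q).
Proof. by move=> Gp Gq m; rewrite mcoeffD; apply: GD. Qed.

Lemma piece_poly_sum d (I : Type) (r : seq I) (P : pred I) F :
  (forall i, P i -> piece_poly d (F i)) ->
  piece_poly d (\sum_(i <- r | P i) F i).
Proof.
move=> GF; apply: big_ind => //; last by move=> *; apply: piece_polyD.
by move=> m; rewrite mcoeff0.
Qed.

Lemma piece_polyM d e p q :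
  piece_poly d p -> piece_poly e q -> piece_poly (d + e) (p * q).
Proof.
by move=> Gp Gq m; rewrite mcoeffM; apply: G_sum => k _; apply: GM.
Qed.

Lemma piece_polyC d a : G d a -> piece_poly d a%:MP.
Proof.
by move=> Ga m; rewrite mcoeffC; case: eqP; rewrite ?mulr1 ?mulr0.
Qed.

Lemma piece_polyS d c p : piece_poly d p -> piece_poly d (sc c * p).
Proof.
move=> Gp m; rewrite mcoeffM; apply: G_sum => k _.
by rewrite mcoeff_map_mpoly /= mulr_algl; apply: GZ.
Qed.

Lemma piece_poly_deriv d i p : piece_poly d p -> piece_poly d p^`M(i).
Proof.
move=> Gp m; rewrite mcoeff_deriv; elim: (m i).+1 => [|k IH].
  by rewrite mulr0n.
by rewrite mulrS; apply: GD.
Qed.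

Section Basis.
Variables (d r : nat) (b : 'I_r -> A).
Hypothesis Gb : forall i, G d (b i).
Hypothesis b_free : forall c, \sum_i c i *: b i = 0 -> forall i, c i = 0.
Hypothesis b_gen : forall a, G d a -> exists c, a = \sum_i c i *: b i.

Definition combination (c : 'I_r -> {mpoly K[n]}) : {mpoly A[n]} :=
  \sum_i sc (c i) * (b i)%:MP.

Lemma piece_poly_combination c : piece_poly d (combination c).
Proof.
by apply: piece_poly_sum => i _; apply/piece_polyS/piece_polyC.
Qed.

Lemma piece_polyP p : piece_poly d p -> exists c, p = combination c.
Proof.
move=> Gp; rewrite [p]mpolyE.
apply: (big_ind (fun q => exists c, q = combination c)).
- exists (fun _ => 0); rewrite /combination big1 // => i _.
  by rewrite rmorph0 mul0r.
- move=> _ _ [c ->] [e ->]; exists (fun i => c i + e i).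
  rewrite /combination -big_split; apply: eq_bigr => i _.
  by rewrite rmorphD mulrDl.
- move=> m _; have [c ->] := b_gen (Gp m).
  exists (fun i => c i *: 'X_[m]); rewrite scaler_suml.
  apply: eq_bigr => i _; rewrite /scalar_poly map_mpolyZ map_mpolyX /=.
  by rewrite mulrC mul_mpolyC scalerA mulr_algr.
Qed.

Lemma combination_eq0 c : combination c = 0 -> forall i, c i = 0.
Proof.
move=> c0 i; apply/mpolyP => m; rewrite mcoeff0.
move: i; apply: b_free.
have := congr1 (mcoeff m) c0; rewrite mcoeff0 raddf_sum /= => e.
by rewrite -[RHS]e; apply: eq_bigr => i _; rewrite mcoeff_scalarMC.
Qed.

Lemma combination_mulmx s (M : 'I_s -> 'I_r -> {mpoly K[n]}) c :
  \sum_i sc (c i) * combination (M i)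
    = combination (fun j => \sum_i c i * M i j).
Proof.
rewrite /combination; under eq_bigr do rewrite mulr_sumr.
rewrite exchange_big; apply: eq_bigr => j _ /=.
rewrite rmorph_sum mulr_suml; apply: eq_bigr => i _.
by rewrite rmorphM mulrA.
Qed.

Lemma combination_dep (y : 'I_r.+1 -> {mpoly A[n]}) :
  (forall k, piece_poly d (y k)) ->
  exists c : 'I_r.+1 -> {mpoly K[n]},
    ~ (forall k, c k = 0) /\ \sum_k sc (c k) * y k = 0.
Proof.
move=> Gy; have [M yM] := fin_all_exists (fun k => piece_polyP (Gy k)).
(* A zero column makes the coordinate matrix square and singular, so that it has a kernel vector
   over [{mpoly K[n]}]. *)
pose N : 'M[{mpoly K[n]}]_r.+1 :=
  \matrix_(k, j) if unlift ord0 j is Some j' then M k j' else 0.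
have /det0P[c c0 cN] : \det N == 0.
  rewrite (expand_det_col _ ord0) big1 // => k _.
  by rewrite mxE unlift_none mul0r.
exists (c 0); split.
  move=> z; case/eqP: c0; apply/rowP => k; rewrite z mxE //.
under eq_bigr do rewrite yM; rewrite combination_mulmx.
rewrite /combination big1 // => j _.
have := congr1 (fun w : 'rV_r.+1 => w 0 (lift ord0 j)) cN; rewrite !mxE => e.
rewrite (_ : \sum_i _ = 0) ?rmorph0 ?mul0r // -[RHS]e.
by apply: eq_bigr => k _; rewrite mxE liftK.
Qed.

End Basis.

(* [delta] is the determinant of multiplication by [p] in bases of [G d] and
   [G e]. *)
Lemma generic_bijection (p : {mpoly A[n]}) (d e r : nat) :
  has_dim (G d) r -> has_dim (G e) r ->
  (forall a, G d a -> piece_poly e (p * a%:MP)) ->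
  (forall q, piece_poly d q -> p * q = 0 -> q = 0) ->
  exists2 delta : {mpoly K[n]}, delta != 0 &
    forall v, delta.@[v] != 0 -> let l := p.@[fun i => (v i)%:A] in
      (forall a, G d a -> l * a = 0 -> a = 0) /\
      (forall a', G e a' -> exists2 a, G d a & l * a = a').
Proof.
move=> [b [Gb b_free b_gen]] [b' [Gb' b'_free b'_gen]] pG p_inj.
have [M pM] := fin_all_exists (fun i => piece_polyP b'_gen (pG _ (Gb i))).
pose N : 'M_r := \matrix_(i, j) M i j.
exists (\det N).
  (* A kernel vector of the matrix would be the coordinates of a nonzero [q] with [p * q = 0]. *)
  apply/negP => /det0P[c c0 cN]; case/eqP: c0; apply/rowP => i; rewrite mxE.
  move: i; apply: (combination_eq0 b_free); apply: p_inj.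
    exact: piece_poly_combination.
  rewrite /combination mulr_sumr.
  under eq_bigr do rewrite mulrCA pM.
  rewrite combination_mulmx /combination big1 // => j _.
  have := congr1 (fun w : 'rV_r => w 0 j) cN; rewrite !mxE => e0.
  rewrite (_ : \sum_i _ = 0) ?rmorph0 ?mul0r // -[RHS]e0.
  by apply: eq_bigr => k _; rewrite mxE.
move=> v; rewrite -[_.@[v]](det_map_mx (meval v)) => Nv l.
set Mv := map_mx _ N in Nv.
(* Evaluated at [v], the matrix represents multiplication by [l] over the field [K]; its
   invertibility gives both claims. *)
have lE (c : 'rV[K]_r) :
    l * (\sum_i c 0 i *: b i) = \sum_j (c *m Mv) 0 j *: b' j.
  rewrite mulr_sumr; under [RHS]eq_bigr do rewrite mxE scaler_suml.
  rewrite exchange_big; apply: eq_bigr => i _ /=.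
  have := congr1 (meval (fun i => (v i)%:A)) (pM i).
  rewrite mevalM mevalC -/l => pb; rewrite -scalerAr pb.
  rewrite /combination rmorph_sum scaler_sumr; apply: eq_bigr => j _ /=.
  by rewrite mevalM mevalC meval_scalar_poly mulr_algl !mxE scalerA.
have uM : Mv \in unitmx by rewrite unitmxE unitfE.
split=> [a /b_gen[c ->]|a' /b'_gen[c ->]].
  rewrite (eq_bigr (fun i => (\row_j c j) 0 i *: b i)); last first.
    by move=> i _; rewrite mxE.
  rewrite lE => /b'_free cM0.
  have c0 : \row_j c j = 0.
    rewrite -[LHS](mulmxK uM) (_ : _ *m Mv = 0) ?mul0mx //.
    by apply/rowP => j; rewrite cM0 mxE.
  by rewrite big1 // => i _; rewrite c0 mxE scale0r.
exists (\sum_i (\row_j c j *m invmx Mv) 0 i *: b i).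
  by apply: G_sum => i _; apply: GZ.
by rewrite lE mulmxKV //; apply: eq_bigr => j _; rewrite mxE.
Qed.

End Fixed.
End GradedPolynomials.

Lemma sum_ord5 (V : zmodType) (F : 'I_5 -> V) :
  \sum_i F i = F (inord 0) + F (inord 1) + F (inord 2) + F (inord 3)
    + F (inord 4).
Proof.
rewrite !big_ord_recl big_ord0 addr0 !addrA.
by congr (F _ + F _ + F _ + F _ + F _); apply: val_inj; rewrite /= inordK.
Qed.

(** * The generic linear form and its specialization to a Lefschetz element *)

Section LefschetzElement.
Variables (K : fieldType) (A : comAlgType K) (G : nat -> A -> Prop).
Hypothesis charK : [pchar K] =i pred0.
Hypothesis G0 : forall d, G d 0.
Hypothesis GD : forall d a b, G d a -> G d b -> G d (a + b).
Hypothesis GZ : forall d c a, G d a -> G d (c *: a).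
Hypothesis GM : forall d e a b, G d a -> G e b -> G (d + e) (a * b).
Hypothesis G1 : G 0 1.
Hypothesis G_nondeg : forall d a,
  (d <= 4)%N -> G d a -> (forall b, G 1 b -> b * a = 0) -> a = 0.
Variables (k : nat) (l : A).
Hypothesis dim0 : has_dim (G 0) 1.
Hypothesis dim1 : has_dim (G 1) 4.
Hypothesis dim2 : has_dim (G 2) k.
Hypothesis dim3 : has_dim (G 3) k.
Hypothesis dim4 : has_dim (G 4) 4.
Hypothesis dim5 : has_dim (G 5) 1.
Hypothesis Gl : G 1 l.
Hypothesis l_inj1 : forall a, G 1 a -> l * a = 0 -> a = 0.
Hypothesis l_inj2 : forall a, G 2 a -> l * a = 0 -> a = 0.

Local Notation piece_poly := (@piece_poly K A G 5).
Local Notation sc := (@scalar_poly K A 5).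

Section Form.
Variable b : 'I_4 -> A.
Hypothesis Gb : forall i, G 1 (b i).
Hypothesis b_free : forall c, \sum_i c i *: b i = 0 -> forall i, c i = 0.
Hypothesis b_gen : forall a, G 1 a -> exists c, a = \sum_i c i *: b i.

(* The generic linear form, with [l] as a redundant extra generator: being
   the leading coefficient, it makes [x] inherit the injectivity of [l]. *)
Definition form_coef (i : 'I_5) : A :=
  if unlift ord0 i is Some j then b j else l.

Definition generic_form : {mpoly A[5]} := \sum_i (form_coef i)%:MP * 'X_i.

Local Notation x := generic_form.

Lemma form_coefG i : G 1 (form_coef i).
Proof. by rewrite /form_coef; case: unliftP => [j|] _. Qed.

Lemma mcoeff_generic_form m :
  x@_m = \sum_i form_coef i * (U_(i)%MM == m)%:R.
Proof.
by rewrite raddf_sum; apply: eq_bigr => i _; rewrite /= mcoeffCM mcoeffX.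
Qed.

Lemma generic_formG : piece_poly 1 x.
Proof.
move=> m; rewrite mcoeff_generic_form; apply: G_sum => // i _.
by rewrite mulr_natr; case: eqP => _; rewrite ?mulr1n //; apply: form_coefG.
Qed.

Lemma generic_form_deriv i : x^`M(i) = (form_coef i)%:MP.
Proof.
rewrite /generic_form raddf_sum (bigD1 i) //= big1 => [|j ji].
  rewrite mderiv_mulC mderivX mnm1E eqxx scale1r addr0.
  have -> : (U_(i) - U_(i) = 0)%MM.
    by apply/mnmP => j; rewrite mnmBE mnm0E subnn.
  by rewrite mpolyX0 mulr1.
by rewrite mderiv_mulC mderivX mnm1E (negPf ji) scale0r mulr0.
Qed.

Lemma generic_form_eval v :
  G 1 (x.@[fun i => (v i)%:A]).
Proof.
rewrite rmorph_sum; apply: G_sum => // i _ /=.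
by rewrite mevalM mevalC mevalXU mulr_algr; apply/GZ/form_coefG.
Qed.

Lemma le_mlead_generic_form : (mlead x <= U_(ord0)%MM)%O.
Proof.
have [->|x0] := eqVneq x 0; first by rewrite mlead0 le0x.
have := mlead_supp x0; rewrite mcoeff_msupp mcoeff_generic_form => nz.
have [j /eqP <-] : exists j, U_(j)%MM == mlead x.
  apply/existsP; apply: contraNT nz; rewrite negb_exists => /forallP nz.
  by rewrite big1 // => i _; rewrite (negPf (nz i)) mulr0.
have [->//|j0] := eqVneq j ord0; apply: ltW; apply/ltmcP.
  by rewrite !mdeg1.
exists ord0 => [i|]; first by rewrite ltn0.
by rewrite !mnm1E eqxx (negPf j0).
Qed.

(** The coefficient of [x * p] at [U_(ord0) + mlead p] is [l] times the leading coefficient of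
    [p]. *)
Lemma generic_form_inj d p : (forall a, G d a -> l * a = 0 -> a = 0) ->
  piece_poly d p -> x * p = 0 -> p = 0.
Proof.
move=> inj Gp xp; apply/eqP; rewrite -mleadc_eq0; apply/eqP.
apply: inj => //; have := congr1 (mcoeff (U_(ord0) + mlead p)%MM) xp.
rewrite (mleadcMW le_mlead_generic_form) // mcoeff0 => e; rewrite -[RHS]e.
rewrite mcoeff_generic_form (bigD1 ord0) //= eqxx mulr1 big1 => [|i i0].
  by rewrite addr0 /form_coef unlift_none.
by rewrite eq_mnm1 (negPf i0) mulr0.
Qed.

Lemma generic_dep y0 y1 y2 y3 y4 :
  piece_poly 1 y0 -> piece_poly 1 y1 -> piece_poly 1 y2 ->
  piece_poly 1 y3 -> piece_poly 1 y4 ->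
  exists c0 c1 c2 c3 c4,
    ~ [/\ c0 = 0, c1 = 0, c2 = 0, c3 = 0 & c4 = 0] /\
    sc c0 * y0 + sc c1 * y1 + sc c2 * y2 + sc c3 * y3 + sc c4 * y4 = 0.
Proof.
move=> G0' G1' G2 G3 G4; pose s := [:: y0; y1; y2; y3; y4].
have [|c [c0 rel]] := @combination_dep _ _ _ 5 _ _ _ b_gen (fun i => s`_i).
  by case; do 5?[case=> //].
exists (c (inord 0)), (c (inord 1)), (c (inord 2)), (c (inord 3)),
  (c (inord 4)); split.
  case=> e0 e1 e2 e3 e4; apply: c0 => i; rewrite -[i]inord_val.
  by case: i => [[|[|[|[|[|//]]]]] lt] /=.
by rewrite sum_ord5 !inordK in rel.
Qed.

(** Only the variables attached to the basis are differentiated, not the extra one attached to [l];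
    they already reach every direction in [A_1[X]]. *)
Lemma directional_derivation (c : 'I_4 -> {mpoly K[5]}) :
  let D p := \sum_j sc (c j) * p^`M(lift ord0 j) in
  [/\ derivation D, D x = combination b c, forall a, D a%:MP = 0
    & forall d p, piece_poly d p -> piece_poly d (D p)].
Proof.
split.
- split=> p q; rewrite -?big_split.
    by apply: eq_bigr => j _; rewrite /= mderivD mulrDr.
  rewrite mulr_suml mulr_sumr -big_split; apply: eq_bigr => j _ /=.
  by rewrite mderivM; ring.
- apply: eq_bigr => j _; rewrite generic_form_deriv.
  by rewrite /form_coef liftK.
- by move=> a; rewrite big1 // => j _; rewrite mderivC mulr0.
- move=> d p Gp; apply: piece_poly_sum => // j _.
  by apply: piece_polyS => //; apply: piece_poly_deriv.
Qed.

Let const_form (p : {mpoly A[5]}) : Prop := exists2 a, G 1 a & p = a%:MP.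

Lemma generic_nondeg d p : (d <= 4)%N -> piece_poly d p ->
  (forall b, const_form b -> b * p = 0) -> p = 0.
Proof.
move=> d4 Gp ann; apply/mpolyP => m; rewrite mcoeff0.
apply: (G_nondeg d4 (Gp m)) => a Ga.
by rewrite -mcoeffCM ann ?mcoeff0 //; exists a.
Qed.

Lemma generic_direction y : piece_poly 1 y ->
  exists D, [/\ derivation D, D x = y
              & forall p, piece_poly 1 p -> piece_poly 1 (D p)].
Proof.
case/(piece_polyP b_gen) => c ->.
have [derD Dx _ DG] := directional_derivation c.
by eexists; split; [exact: derD|exact: Dx|exact: DG].
Qed.

Lemma generic_constant_direction y : const_form y ->
  exists D, [/\ derivation D, D x = y, D y = 0
              & forall p, piece_poly 1 p -> piece_poly 1 (D p)].
Proof.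
case=> a /b_gen[c ->] ->.
have [derD Dx DC DG] := directional_derivation (fun j => (c j)%:MP).
eexists; split; [exact: derD| |exact: DC|exact: DG].
rewrite [LHS]Dx rmorph_sum; apply: eq_bigr => j _.
by rewrite /= scalar_polyC.
Qed.

Lemma generic_natr m : m.+1%:R != 0 :> {mpoly K[5]}.
Proof. by rewrite -mpolyC_nat mpolyC_eq0 natr_neq0. Qed.

Lemma generic_form5 : x ^+ 5 <> 0.
Proof.
apply: (generic_power_neq0 generic_natr (@scalar_poly_torsion_free K A 5)
  (@piece_polyM _ _ _ G0 GD GM 5) generic_formG generic_nondeg
  generic_constant_direction).
exists (b ord0)%:MP; first by exists (b ord0).
move/eqP; rewrite mpolyC_eq0 => /eqP b0.
have /b_free/(_ ord0)/eqP : \sum_i (i == ord0)%:R *: b i = 0.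
  rewrite (bigD1 ord0) //= b0 scaler0 add0r big1 // => i /negPf ->.
  by rewrite scale0r.
by rewrite eqxx oner_eq0.
Qed.

Lemma generic_form3_inj h : piece_poly 1 h -> x ^+ 3 * h = 0 -> h = 0.
Proof.
apply: (kernel_trivial generic_natr (@scalar_poly_torsion_free K A 5)
  (@piece_polyM _ _ _ G0 GD GM 5) generic_dep generic_formG generic_nondeg _ _
  generic_direction generic_constant_direction generic_form5).
- by move=> _ [a Ga ->]; apply: piece_polyC.
- move=> _ _ [a Ga ->] [a' Ga' ->]; exists (a + a'); first exact: GD.
  by rewrite mpolyCD.
- by move=> p; apply: generic_form_inj.
- by move=> p; apply: generic_form_inj.
Qed.

Lemma generic_form5_inj q : piece_poly 0 q -> x ^+ 5 * q = 0 -> q = 0.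
Proof.
have [u [Gu _ u_gen]] := dim0.
case/(piece_polyP u_gen) => c ->; rewrite /combination big_ord1.
have [t] := u_gen _ G1; rewrite big_ord1 => tu.
rewrite mulrCA => e; have [->|c0] := eqVneq (c ord0) 0.
  by rewrite rmorph0 mul0r.
(* Multiplying by [t] turns the generator [u] of degree 0 into 1. *)
have {}e := scalar_poly_torsion_free c0 e; case: generic_form5.
have := congr1 (fun p => sc (t 0)%:MP * p) e.
by rewrite mulr0 mulrCA scalar_polyC -tu mpolyC1 mulr1.
Qed.

End Form.

Lemma strong_Lefschetz_element : exists2 l' : A, G 1 l' &
  [/\ forall a, G 2 a -> l' * a = 0 -> a = 0,
      forall a, G 1 a -> l' ^+ 3 * a = 0 -> a = 0,
      forall a', G 4 a' -> exists2 a, G 1 a & l' ^+ 3 * a = a',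
      forall a, G 0 a -> l' ^+ 5 * a = 0 -> a = 0
    & forall a', G 5 a' -> exists2 a, G 0 a & l' ^+ 5 * a = a'].
Proof.
have [b [Gb b_free b_gen]] := dim1.
pose x := generic_form b.
have Gx : piece_poly 1 x by apply: generic_formG.
have GX m : piece_poly m.+1 (x ^+ m.+1).
  elim: m => [//|m IH]; rewrite exprS; exact: (piece_polyM G0 GD GM Gx IH).
have GXa m d a : G d a -> piece_poly (m.+1 + d) (x ^+ m.+1 * a%:MP).
  by move=> Ga; apply: piece_polyM => //; apply: piece_polyC.
(* The exponents in [GXa] are shifted by one: 0, 2, 4 stand for [x], [x ^+ 3], [x ^+ 5]. *)
have [d1 nz1 D1] := generic_bijection G0 GD GZ dim2 dim3 (@GXa 0%N 2%N)
  (fun q => generic_form_inj l_inj2).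
have [d3 nz3 D3] := generic_bijection G0 GD GZ dim1 dim4 (@GXa 2%N 1%N)
  (generic_form3_inj Gb b_free b_gen).
have [d5 nz5 D5] := generic_bijection G0 GD GZ dim0 dim5 (@GXa 4%N 0%N)
  (generic_form5_inj Gb b_free b_gen).
have [|v] := @mpoly_nonzero_point K 5 charK (d1 * d3 * d5).
  by rewrite !mulf_neq0.
rewrite !mevalM !mulf_eq0 !negb_or => /andP[/andP[v1 v3] v5].
have [i1 _] := D1 _ v1; have [i3 s3] := D3 _ v3; have [i5 s5] := D5 _ v5.
exists x.@[fun i => (v i)%:A]; first exact: generic_form_eval.
move: i1 i3 s3 i5 s5; rewrite /= !rmorphXn expr1.
by split.
Qed.

End LefschetzElement.

(** * Graded quotients of polynomial rings *)

Section GradedPieces.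
Variables (K : fieldType) (n : nat) (I : idealr {mpoly K[n]}).
Local Notation cls := (@quot_cls K n I).
Local Notation G := (@graded_piece K n I).

Lemma quot_cls0 : cls 0 = 0.
Proof. exact: (rmorph0 (\pi_{ideal_quot I})%qT). Qed.

Lemma quot_clsB p q : cls (p - q) = cls p - cls q.
Proof. exact: (rmorphB (\pi_{ideal_quot I})%qT). Qed.

Lemma quot_cls_eq0 p : (cls p == 0) = (p \in I).
Proof.
by rewrite -[in RHS](subr0 p) Quotient.idealrBE -quot_cls0.
Qed.

Lemma graded_piece0 d : G d 0.
Proof. by exists 0; rewrite ?quot_cls0 ?dhomog0. Qed.

Lemma graded_piece1 : G 0 1.
Proof. by exists 1; rewrite ?quot_cls1 ?dhomog1. Qed.

Lemma graded_pieceD d a b : G d a -> G d b -> G d (a + b).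
Proof.
move=> [p hp ->] [q hq ->]; exists (p + q); rewrite ?quot_clsD //.
exact: dhomogD.
Qed.

Lemma graded_pieceZ d c a : G d a -> G d (c *: a).
Proof.
move=> [p hp ->]; exists (c%:MP * p); last by rewrite quot_clsM.
by rewrite mul_mpolyC; apply: dhomogZ.
Qed.

Lemma graded_pieceM d e a b : G d a -> G e b -> G (d + e) (a * b).
Proof.
move=> [p hp ->] [q hq ->]; exists (p * q); last by rewrite quot_clsM.
exact: dhomogM.
Qed.

(** With [p] and [q] representing [a] in degrees [d] and [e], the degree [d] component of [p - q] is
    [p], which homogeneity puts in [I]. *)
Lemma graded_piece_direct (homI : homogeneous_ideal I) d e a :
  d != e -> G d a -> G e a -> a = 0.
Proof.
move=> de [p hp ->] [q hq pq]; apply/eqP; rewrite quot_cls_eq0.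
have /(homI _ d) : p - q \in I by rewrite -quot_cls_eq0 quot_clsB pq subrr.
by rewrite pihomogB (pihomog_dE hp) (pihomog_ne0 _ hq) ?subr0 // eq_sym.
Qed.

(* A is generated in degree 1. *)
Lemma annihilator_degree1 a : (forall c, G 1 c -> c * a = 0) -> socle a.
Proof.
move=> ann d _ d0 [p hp ->]; rewrite [p]mpolyE.
rewrite (big_morph cls (@quot_clsD K n I) quot_cls0) mulr_suml big_seq.
rewrite big1 // => m mp.
have [i mi] : exists i, m i != 0%N.
  apply: mnm_neq0 => m0; move: (dhomog_mf hp mp) d0 => /= <-.
  by rewrite m0 mdeg0.
have -> : m = (m - U_(i) + U_(i))%MM by rewrite submK // lep1mP.
rewrite mpolyXD -mul_mpolyC mulrA quot_clsM -mulrA ann ?mulr0 //.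
by exists 'X_i => //; rewrite dhomogX /= mdeg1.
Qed.

(** Source of the nondegeneracy hypothesis. A nonzero [t] of top degree spans the one-dimensional
    socle, which contains [a]; so [a] lies in degree [s] as well as in degree [d < s]. *)
Lemma graded_socle (homI : homogeneous_ideal I) s d a :
  socle_degree I s -> has_dim (@socle K n I) 1 ->
  (d < s)%N -> G d a -> (forall c, G 1 c -> c * a = 0) -> a = 0.
Proof.
move=> [[t Gt t0] Gs] [e [_ _ e_gen]] ds Ga /annihilator_degree1 soc_a.
have soc_t : socle t.
  move=> j b j0 Gb; apply: (Gs (j + s)%N); last exact: graded_pieceM.
  by rewrite -[X in (X < _)%N]add0n ltn_add2r.
have [ct tE] := e_gen _ soc_t; have [ca aE] := e_gen _ soc_a.
rewrite big_ord1 in tE; rewrite big_ord1 in aE.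
have c0 : ct ord0 != 0.
  by apply: contraNneq t0 => c0; rewrite tE c0 scale0r.
apply: (graded_piece_direct homI _ Ga (e := s)); first by rewrite ltn_eqF.
have -> : a = (ca ord0 / ct ord0) *: t by rewrite tE scalerA divfK.
exact: graded_pieceZ.
Qed.

End GradedPieces.

(** In the surjective case, preimages of the target basis give a one-sided inverse of the matrix,
    whose rank is then at least [s], hence at least [r]: its rows are free. *)
Lemma maximal_rank_inj (K : fieldType) (n : nat) (I : idealr {mpoly K[n]})
    (l : quot_alg I) (d e r s : nat) :
  has_dim (@graded_piece K n I d) r -> has_dim (@graded_piece K n I e) s ->
  (r <= s)%N ->
  (forall a, graded_piece d a -> graded_piece e (l * a)) ->
  mul_maximal_rank l d e ->
  forall a, graded_piece d a -> l * a = 0 -> a = 0.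
Proof.
move=> [b [Gb b_free b_gen]] [b' [Gb' b'_free b'_gen]] rs lG.
case=> [inj a Ga la|surj].
  by apply: (inj) => //; [apply: graded_piece0|rewrite la mulr0].
have [M lM] := fin_all_exists (fun i => b'_gen _ (lG _ (Gb i))).
have pre j : exists c : 'I_r -> K, l * (\sum_i c i *: b i) = b' j.
  by have [_ /b_gen[c ->] lb] := surj _ (Gb' j); exists c.
have [N lN] := fin_all_exists pre.
pose mM : 'M_(r, s) := \matrix_(i, j) M i j.
pose mN : 'M_(s, r) := \matrix_(j, i) N j i.
have lE (c : 'rV_r) :
    l * (\sum_i c 0 i *: b i) = \sum_j (c *m mM) 0 j *: b' j.
  rewrite mulr_sumr; under [RHS]eq_bigr do rewrite mxE scaler_suml.
  rewrite exchange_big; apply: eq_bigr => i _ /=.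
  rewrite -scalerAr lM scaler_sumr; apply: eq_bigr => j _.
  by rewrite mxE scalerA.
have NM : mN *m mM = 1%:M.
  apply/row_matrixP => j; rewrite row_mul; apply/rowP => j'.
  apply/eqP; rewrite -subr_eq0; apply/eqP; move: j'.
  apply: (b'_free (fun j' => _)).
  under eq_bigr do rewrite scalerBl.
  rewrite sumrB -lE (eq_bigr (fun i => N j i *: b i)) => [|i _]; last first.
    by rewrite !mxE.
  rewrite lN (bigD1 j) //= !mxE eqxx scale1r big1 ?addr0 ?subrr // => i ij.
  by rewrite !mxE eq_sym (negPf ij) scale0r.
have freeM : row_free mM.
  rewrite /row_free eqn_leq rank_leq_row (leq_trans rs) //.
  by rewrite -{1}(mxrank1 K s) -NM mxrankM_maxr.
move=> a /b_gen[c ->].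
rewrite (eq_bigr (fun i => (\row_j c j) 0 i *: b i)); last first.
  by move=> i _; rewrite mxE.
rewrite lE => /b'_free cM0.
have /eqP : \row_j c j *m mM = 0 by apply/rowP => j; rewrite cM0 mxE.
rewrite mulmx_free_eq0 // => /eqP ->.
by rewrite big1 // => i _; rewrite mxE scale0r.
Qed.

(** * The strong Lefschetz property from the powers 1, 3 and 5 *)

Theorem proposition2p5 (K : fieldType) (charK : [pchar K] =i pred0)
    (I : idealr {mpoly K[4]}) (k : nat)
    (homI : homogeneous_ideal I)
    (no_linear : forall p : {mpoly K[4]},
      p \is 1.-homog -> p \in I -> p = 0)
    (gorA : artinian_gorenstein I)
    (k_range : (4 <= k <= 10)%N)
    (HA : H_vector I [:: 1; 4; k; k; 4; 1]%N)
    (wlpA : weak_Lefschetz I) :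
  strong_Lefschetz I.
Proof.
have [s [socI [/esym s5] dimI]] := HA; subst s.
have [_ soc1] := gorA; have [l Gl lr] := wlpA.
have [_ Gvan] := socI.
pose GM := @graded_pieceM K 4 I.
have dim2 := dimI 2%N isT; have dim3 := dimI 3%N isT.
have inj1 : forall a, graded_piece 1 a -> l * a = 0 -> a = 0.
  apply: (maximal_rank_inj (dimI 1%N isT) dim2) (lr 1%N).
    by case/andP: k_range.
  by move=> a; apply: (GM 1%N 1%N).
have inj2 : forall a, graded_piece 2 a -> l * a = 0 -> a = 0.
  apply: (maximal_rank_inj dim2 dim3) (lr 2%N) => // a; exact: (GM 1%N 2%N).
have [l' Gl' [i1 i3 s3 i5 s5]] := strong_Lefschetz_element charK
  (@graded_piece0 K 4 I) (@graded_pieceD K 4 I) (@graded_pieceZ K 4 I) GM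
  (@graded_piece1 K 4 I) (fun d a d4 => graded_socle homI socI soc1 d4)
  (dimI 0%N isT) (dimI 1%N isT) dim2 dim3 (dimI 4%N isT) (dimI 5%N isT)
  Gl inj1 inj2.
have GX m d a : graded_piece d a -> graded_piece (m + d) (l' ^+ m * a).
  move=> Ga; elim: m => [|m IH]; first by rewrite mul1r.
  by rewrite exprS -mulrA; apply: (GM _ _ _ _ Gl' IH).
exists l' => // i m.
have injP : (forall a, graded_piece i a -> l' ^+ m * a = 0 -> a = 0) ->
    mul_maximal_rank (l' ^+ m) i (i + m).
  move=> inj; left=> a b Ga Gb ab; apply/eqP; rewrite -subr_eq0; apply/eqP.
  apply: inj; last by rewrite mulrBr ab subrr.
  by rewrite -scaleN1r; apply: graded_pieceD => //; apply: graded_pieceZ.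
(* Injectivity passes from a power of [l'] to all smaller powers. *)
have below j a : (m <= j)%N -> l' ^+ m * a = 0 -> l' ^+ j * a = 0.
  by move=> mj ma; rewrite -(subnK mj) exprD -mulrA ma mulr0.
have [im|im] := ltnP 5 (i + m).
  right=> b /(Gvan _ im) ->; exists 0; last exact: mulr0.
  exact: graded_piece0.
have [i0|i_gt0] := posnP i.
  apply: injP => a; rewrite i0 => Ga ma.
  by apply: i5 => //; apply: below ma; lia.
(* Surjectivity of [l' ^+ 5] from degree 0 factors through degree [i]; the next case does the same
   with [l' ^+ 3] from degree 1. *)
have [im5|im5] := eqVneq (i + m)%N 5.
  right=> b; rewrite im5 => /s5[a Ga <-]; exists (l' ^+ i * a).
    by rewrite -[i in graded_piece i _]addn0; apply: GX.
  by rewrite mulrA -exprD addnC im5.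
have [im4|im4] := eqVneq (i + m)%N 4.
  right=> b; rewrite im4 => /s3[a Ga <-]; exists (l' ^+ i.-1 * a).
    by have := GX i.-1 _ _ Ga; rewrite addn1 prednK.
  by rewrite mulrA -exprD; congr (_ ^+ _ * _); lia.
(* Now [0 < i] and [i + m <= 3]: for positive [m], either [i = 1] and [l' ^+ 3] decides, or [i = 2]
   and [m = 1]. *)
apply: injP => a Ga ma.
have [m0|m_gt0] := posnP m; first by rewrite m0 mul1r in ma.
have [i1E|i2E] : i = 1%N \/ i = 2%N by lia.
  by rewrite i1E in Ga; apply: i3 => //; apply: below ma; lia.
rewrite i2E in Ga; apply: i1 => //; rewrite -[l']expr1.
by apply: below ma; lia.
Qed.
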